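(* Suppose $\bigcap_{i=1}^3\Theta_i=\emptyset$. The problem of minimizing $\mathcal{H}(x)=\sum_{i=1}^3 D(x;\Theta_i)$ over $x\in\mathbb{R}^2$ has more than one solution if and only if there are distinct indices $i,j,k\in\{1,2,3\}$ such that the set $[b_i,b_j]\cap\Theta_k$ contains a point $u$ belonging to the interior of $\Theta_k$ with $|A(u)|=1$.
   Context: $\mathbb{R}^2$ carries the Euclidean norm $\|\cdot\|$. $\Theta_i=\mathbb{B}(b_i;s_i)=\{x : \|x-b_i\|\le s_i\}$, $s_i\ge 0$, $i=1,2,3$, are three closed balls in $\mathbb{R}^2$ with distinct centers $b_1,b_2,b_3$ (radius $0$ allowed). $D(x;Q)=\inf\{\|x-q\| : q\in Q\}$. $[a,b]$ is the closed line segment joining $a$ and $b$. For $u\in\mathbb{R}^2$, $A(u)=\{i\in\{1,2,3\} : u\in\Theta_i\}$. A solution is a global minimizer of $\mathcal{H}$ on $\mathbb{R}^2$. *)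

(* Defs.v *)
From HB Require Import structures.
From mathcomp Require Import all_boot all_order all_algebra.
From mathcomp Require Import all_classical all_reals.
From mathcomp Require Import topology normedtype.
Set Implicit Arguments.
Unset Strict Implicit.
Unset Printing Implicit Defensive.
Import Order.TTheory GRing.Theory Num.Theory.
Import numFieldNormedType.Exports.
Local Open Scope classical_set_scope.
Local Open Scope ring_scope.

(* The library norm [`|x|] on row vectors is the sup norm, hence a separate
   Euclidean norm. The two norms induce the same topology on ['rV[R]_n], so the
   library's [interior] is the Euclidean interior. *)
Definition enorm (R : realType) (n : nat) (x : 'rV[R]_n) : R :=
  Num.sqrt (\sum_(j < n) x 0 j ^+ 2).

Definition eball (R : realType) (n : nat) (b : 'rV[R]_n) (s : R) :
    set 'rV[R]_n :=
  [set x | enorm (x - b) <= s].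

Definition set_dist (R : realType) (n : nat) (x : 'rV[R]_n)
    (Q : set 'rV[R]_n) : R :=
  inf [set enorm (x - q) | q in Q].

Definition segment (R : realType) (n : nat) (a b : 'rV[R]_n) :
    set 'rV[R]_n :=
  [set (1 - t) *: a + t *: b | t in `[0, 1]].

Definition global_minimizer (R : realType) (T : Type) (f : T -> R) (x : T) :
    Prop :=
  forall y : T, f x <= f y.

Definition active_set (T : Type) (I : finType) (Theta : I -> set T) (u : T) :
    {set I} :=
  [set i : I | u \in Theta i]%SET.

(* Main.v *)
Require Import Defs.
From HB Require Import structures.
From mathcomp Require Import all_boot all_order all_algebra.
From mathcomp Require Import all_classical all_reals.
From mathcomp Require Import topology normedtype realfun.
From mathcomp Require Import ring lra.
Set Implicit Arguments.
Unset Strict Implicit.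
Unset Printing Implicit Defensive.
Import Order.TTheory GRing.Theory Num.Theory.
Import numFieldNormedType.Exports.
Local Open Scope classical_set_scope.
Local Open Scope ring_scope.

(** The distance to a ball with center [b] and radius [s] is [excess b s], the
    positive part of [enorm (x - b) - s], a convex function of [x].

    Suppose that [x] and [y] are two minimizers of the sum of the three
    distances, and let [m] be their midpoint. Convexity at [m] is then an equality
    for each of the three distances ([minimizers_midpoint]). If [m] is outside a
    ball, equality in the triangle inequality puts the center of this ball on the
    line through [x] and [y], not strictly between them, and the distance to the ball
    changes by exactly the length of [x - y], with one sign or the other, from [y]
    to [x] ([excess_midpoint_eq]). If [m] is in the ball, so are [x] and [y], and
    the distance does not change. The three changes add up to zero and at least
    one of them is not zero, because no point is in all three balls. Hence there
    is one of each sign, and the third is zero: [m] is in a single ball, and it is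
    between the two other centers, which are on opposite sides of it. It is
    interior to its ball because balls are strictly convex
    ([eball_midpoint_lt]).

    Conversely, a point of the segment between two centers that is outside their
    balls and inside the third ball attains the lower bound that the triangle
    inequality gives for the sum of the distances to the first two balls
    ([separating_minimizer]). The three conditions persist when the point is moved
    a little along the segment, hence a second minimizer
    ([separating_nonunique]). *)

(** * Euclidean geometry of row vectors *)

Definition dotp (R : realType) (n : nat) (u v : 'rV[R]_n) : R :=
  \sum_(j < n) u 0 j * v 0 j.

Section Enorm.
Context {R : realType} {n : nat}.
Implicit Types (u v x y b : 'rV[R]_n) (a c s t : R).

Lemma enorm_ge0 u : 0 <= enorm u.
Proof. exact: sqrtr_ge0. Qed.

Lemma enorm_sqr u : enorm u ^+ 2 = \sum_(j < n) u 0 j ^+ 2.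
Proof. by rewrite sqr_sqrtr // sumr_ge0 // => j _; exact: sqr_ge0. Qed.

Lemma enorm_sqr_comb a c u v :
  enorm (a *: u + c *: v) ^+ 2 =
  a ^+ 2 * enorm u ^+ 2 + c ^+ 2 * enorm v ^+ 2 + 2 * a * c * dotp u v.
Proof.
rewrite !enorm_sqr /dotp !mulr_sumr -!big_split /=.
by apply: eq_bigr => j _; rewrite !mxE; ring.
Qed.

Lemma enormZ a u : enorm (a *: u) = `|a| * enorm u.
Proof.
rewrite /enorm -sqrtr_sqr -sqrtrM ?sqr_ge0 // mulr_sumr.
by congr Num.sqrt; apply: eq_bigr => j _; rewrite !mxE exprMn.
Qed.

Lemma enormN u : enorm (- u) = enorm u.
Proof. by rewrite -scaleN1r enormZ normrN1 mul1r. Qed.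

Lemma enormB u v : enorm (u - v) = enorm (v - u).
Proof. by rewrite -enormN opprB. Qed.

Lemma enorm_eq0 u : (enorm u == 0) = (u == 0).
Proof.
apply/eqP/eqP => [u0|->]; last first.
  by rewrite -[0](scale0r 0) enormZ normr0 mul0r.
have /eqP : \sum_(j < n) u 0 j ^+ 2 = 0 by rewrite -enorm_sqr u0 expr0n.
rewrite psumr_eq0 => [/allP u2|j _]; last exact: sqr_ge0.
apply/rowP => j; apply/eqP; rewrite mxE -sqrf_eq0.
by apply: u2; rewrite mem_index_enum.
Qed.

Lemma enorm_gt0 u : (0 < enorm u) = (u != 0).
Proof. by rewrite lt_def enorm_ge0 andbT enorm_eq0. Qed.

(** This identity yields the Cauchy-Schwarz inequality and, at the same time,
    describes when it is an equality: the left-hand side vanishes only if [u]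
    and [v] point in the same direction. *)
Lemma enorm_cross_sqr u v :
  enorm (enorm v *: u + (- enorm u) *: v) ^+ 2 =
  2 * (enorm u * enorm v) * (enorm u * enorm v - dotp u v).
Proof. by rewrite enorm_sqr_comb; ring. Qed.

Lemma dotp_le u v : dotp u v <= enorm u * enorm v.
Proof.
have [uv0|uv_neq0] := eqVneq (enorm u * enorm v) 0; last first.
  have uv_gt0 : 0 < 2 * (enorm u * enorm v).
    by rewrite mulr_gt0 // lt_def uv_neq0 mulr_ge0 ?enorm_ge0.
  by rewrite -subr_ge0 -(pmulr_rge0 _ uv_gt0) -enorm_cross_sqr sqr_ge0.
rewrite uv0 /dotp big1 // => j _.
by move/eqP: uv0; rewrite mulf_eq0 !enorm_eq0 => /orP[]/eqP->;
  rewrite mxE ?mul0r ?mulr0.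
Qed.

Lemma enorm_sqrD u v :
  enorm (u + v) ^+ 2 = enorm u ^+ 2 + enorm v ^+ 2 + 2 * dotp u v.
Proof. by rewrite -[u in LHS]scale1r -[v in LHS]scale1r enorm_sqr_comb; ring. Qed.

Lemma enormD u v : enorm (u + v) <= enorm u + enorm v.
Proof.
rewrite -(@ler_pXn2r _ 2) ?nnegrE ?addr_ge0 ?enorm_ge0 // enorm_sqrD.
by have := dotp_le u v; nra.
Qed.

Lemma enorm_same_direction u v :
  enorm (u + v) = enorm u + enorm v -> enorm v *: u = enorm u *: v.
Proof.
move=> uv; apply/eqP; rewrite -subr_eq0 -scaleNr -enorm_eq0 -sqrf_eq0.
rewrite enorm_cross_sqr.
have -> : enorm u * enorm v = dotp u v.
  by have := enorm_sqrD u v; rewrite uv; lra.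
by rewrite subrr mulr0.
Qed.

(** Equality in the triangle inequality puts [u] and [v] on one ray from the
    origin, so that both [u + v] and [u - v] are multiples of its direction;
    eliminating the direction gives this relation. *)
Lemma enorm_ray u v : enorm (u + v) = enorm u + enorm v ->
  (enorm u - enorm v) *: (u + v) = (enorm u + enorm v) *: (u - v).
Proof.
move=> /enorm_same_direction/rowP uv.
by apply/rowP => j; move: (uv j); rewrite !mxE => uvj; nra.
Qed.

Lemma enorm_ray_dist u v : enorm (u + v) = enorm u + enorm v ->
  `|enorm u - enorm v| = enorm (u - v).
Proof.
move=> uv; have := congr1 (@enorm R n) (enorm_ray uv).
rewrite !enormZ uv (@ger0_norm _ (enorm u + enorm v)) ?addr_ge0 ?enorm_ge0 //.
have [/eqP|p0] := eqVneq (enorm u + enorm v) 0; last first.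
  by rewrite [LHS]mulrC => /(mulfI p0).
rewrite paddr_eq0 ?enorm_ge0 // => /andP[/eqP u0 /eqP v0] _.
move: (u0) (v0) => /eqP + /eqP; rewrite !enorm_eq0 => /eqP -> /eqP ->.
by rewrite subrr normr0 subr0; apply/esym/eqP; rewrite enorm_eq0.
Qed.

End Enorm.

(** * Balls: interior and distance *)

Section Ball.
Context {R : realType} {n : nat}.
Implicit Types (x y m b : 'rV[R]_n) (s : R).

Lemma enorm_continuous : continuous (@enorm R n).
Proof.
move=> x; apply: (@continuous_comp _ _ _ _ Num.sqrt); last exact: sqrt_continuous.
apply: (@continuous_big _ _ _ _ xpredT) => [p|j _ z].
  exact: add_continuous.
apply: (@continuous_comp _ _ _ _ (fun t : R => t ^+ 2)).
  exact: coord_continuous.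
exact: exprn_continuous.
Qed.

Lemma interior_eball x b s : enorm (x - b) < s -> interior (eball b s) x.
Proof.
move=> xs; suff cvx : enorm (y - b) @[y --> x] --> enorm (x - b).
  by apply: filterS (cvgr_lt _ cvx _ xs) => y /ltW.
apply: (@continuous_comp _ _ _ (fun y => y - b) (@enorm R n) x).
  by apply: continuousB; [move=> A; exact: cvg_id|exact: cst_continuous].
exact: enorm_continuous.
Qed.

(** Euclidean balls are strictly convex, by the parallelogram law. *)
Lemma eball_midpoint_lt x y b s : x != y -> eball b s x -> eball b s y ->
  enorm (2^-1 *: (x + y) - b) < s.
Proof.
rewrite /eball /= => xy xs ys.
have xy0 : 0 < enorm (x - y) by rewrite enorm_gt0 subr_eq0.
have s0 : 0 <= s := le_trans (enorm_ge0 _) xs.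
have E1 : enorm (2^-1 *: (x + y) - b) ^+ 2
    = (enorm (x - b) ^+ 2 + enorm (y - b) ^+ 2) / 2 - (enorm (x - y) / 2) ^+ 2.
  have -> : 2^-1 *: (x + y) - b = 2^-1 *: (x - b) + 2^-1 *: (y - b).
    by apply/rowP => j; rewrite !mxE; field.
  have -> : x - y = 1 *: (x - b) + (- 1) *: (y - b).
    by apply/rowP => j; rewrite !mxE; ring.
  by rewrite exprMn !enorm_sqr_comb; field.
rewrite -(@ltr_pXn2r _ 2) ?nnegrE ?enorm_ge0 // E1.
have := enorm_ge0 (x - b); have := enorm_ge0 (y - b); nra.
Qed.

Definition excess b s x : R := Num.max 0 (enorm (x - b) - s).

Lemma excess_ge0 b s x : 0 <= excess b s x.
Proof. by rewrite le_max lexx. Qed.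

Lemma excess_ge b s x : enorm (x - b) - s <= excess b s x.
Proof. by rewrite le_max lexx orbT. Qed.

Lemma excess_in b s x : eball b s x -> excess b s x = 0.
Proof. by move=> xs; apply/max_idPl; rewrite subr_le0. Qed.

Lemma excess_out b s x : ~ eball b s x -> excess b s x = enorm (x - b) - s.
Proof.
by move=> /negP; rewrite -ltNge => xs; apply/max_idPr; rewrite subr_ge0 ltW.
Qed.

Lemma set_dist_eball x b s : 0 <= s -> set_dist x (eball b s) = excess b s x.
Proof.
move=> s0; rewrite /set_dist; set E := [set _ | _ in _].
have lbE : lbound E (excess b s x).
  move=> _ [q qs <-]; rewrite ge_max enorm_ge0 lerBlDr.
  have -> : x - b = (x - q) + (q - b) by rewrite addrA subrK.
  by apply: le_trans (enormD _ _) _; rewrite lerD2l.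
suff Ed : E (excess b s x).
  by apply/eqP; rewrite eq_le lb_le_inf ?ge_inf //; exists (excess b s x).
have [xs|xs] := pselect (eball b s x).
  rewrite excess_in //; exists x => //.
  by rewrite subrr; apply/eqP; rewrite enorm_eq0.
rewrite excess_out //; move: xs => /negP; rewrite -ltNge => xs.
have d0 : 0 < enorm (x - b) := le_lt_trans s0 xs.
(* the nearest point is the radial projection of x on the sphere *)
exists (b + (s / enorm (x - b)) *: (x - b)).
  rewrite /eball /= (addrC b) addrK enormZ ger0_norm ?divr_ge0 ?enorm_ge0 //.
  by rewrite divfK ?gt_eqF.
have -> : x - (b + (s / enorm (x - b)) *: (x - b))
    = (1 - s / enorm (x - b)) *: (x - b).
  by apply/rowP => j; rewrite !mxE; ring.
rewrite enormZ ger0_norm; last by rewrite subr_ge0 ler_pdivrMr // mul1r ltW.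
by rewrite mulrBl mul1r divfK ?gt_eqF.
Qed.

Lemma enorm_midpoint x y b :
  2 * enorm (2^-1 *: (x + y) - b) = enorm ((x - b) + (y - b)).
Proof.
have -> : (x - b) + (y - b) = 2 *: (2^-1 *: (x + y) - b).
  by apply/rowP => j; rewrite !mxE; field.
by rewrite enormZ ger0_norm.
Qed.

Lemma excess_midpoint x y b s :
  2 * excess b s (2^-1 *: (x + y)) <= excess b s x + excess b s y.
Proof.
have [ms|ms] := pselect (eball b s (2^-1 *: (x + y))).
  by rewrite excess_in // mulr0 addr_ge0 ?excess_ge0.
rewrite excess_out // mulrBr enorm_midpoint.
have := enormD (x - b) (y - b).
by have := excess_ge b s x; have := excess_ge b s y; lra.
Qed.

(** If the distance to a ball is affine along [x, y] and the midpoint is outside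
    the ball, then all the inequalities giving convexity are equalities: the
    distance is [enorm (_ - b) - s] at both ends too, and [x - b] and [y - b] are
    on one ray from the origin. So the distance has slope [1] or [-1] along the
    line from [x] to [y], and the sign tells on which side of [m] the center is. *)
Lemma excess_midpoint_eq x y b s (m := 2^-1 *: (x + y)) :
  2 * excess b s m = excess b s x + excess b s y -> ~ eball b s m ->
  `|excess b s x - excess b s y| = enorm (x - y) /\
  (excess b s x - excess b s y) *: (m - b)
    = ((enorm (x - b) + enorm (y - b)) / 2) *: (x - y).
Proof.
move=> + ms; rewrite excess_out // mulrBr enorm_midpoint => eqm.
have := enormD (x - b) (y - b).
have := excess_ge b s x; have := excess_ge b s y => gey gex tri.
have -> : excess b s x - excess b s y = enorm (x - b) - enorm (y - b) by lra.
have eqD : enorm ((x - b) + (y - b)) = enorm (x - b) + enorm (y - b) by lra.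
have xyE : (x - b) - (y - b) = x - y by rewrite opprB addrA subrK.
split; first by rewrite enorm_ray_dist // xyE.
have /rowP rayE := enorm_ray eqD.
by apply/rowP => j; move: (rayE j); rewrite !mxE => rayj; lra.
Qed.

End Ball.

(** If [a] and [c] are on opposite rays from [m], at distances proportional to [p]
    and [q], then [m] is their barycenter with weights [q] and [p]. *)
Lemma segment_opposite_rays (R : realType) (n : nat) (a c m w : 'rV[R]_n)
    (d p q : R) :
  0 < d -> 0 < p -> 0 < q ->
  d *: (m - a) = p *: w -> - d *: (m - c) = q *: w -> segment a c m.
Proof.
move=> d0 p0 q0 /rowP rayp /rowP rayq.
have pq : 0 < p + q by exact: addr_gt0.
exists (p / (p + q)) => /=.
  rewrite in_itv /= divr_ge0 ?(ltW p0) ?(ltW pq) //=.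
  by rewrite ler_pdivrMr // mul1r lerDl ltW.
apply/rowP => j; have := rayp j; have := rayq j; rewrite !mxE => rayqj raypj.
have bal : d * ((p + q) * m 0 j) = d * (q * a 0 j + p * c 0 j).
  apply: subr0_eq.
  transitivity (q * (d * (m 0 j - a 0 j)) - p * (- d * (m 0 j - c 0 j))).
    by ring.
  by rewrite raypj rayqj; ring.
apply: (mulfI (lt0r_neq0 pq)); rewrite (mulfI (lt0r_neq0 d0) bal).
by field; rewrite gt_eqF.
Qed.

(** * Three indices *)

Lemma sumr_eq0_gt0 (R : realDomainType) (I : finType) (c : I -> R) (l : I) :
  \sum_i c i = 0 -> c l != 0 -> exists i, 0 < c i.
Proof.
move=> c0 cl; apply/existsP; apply: contraT; rewrite negb_exists => /forallP cle.
have {}cle i : 0 <= - c i by rewrite oppr_ge0 leNgt.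
have /eqP : \sum_i - c i = 0 by rewrite sumrN c0 oppr0.
rewrite psumr_eq0 // => /allP/(_ l (mem_index_enum _)).
by rewrite oppr_eq0 (negPf cl).
Qed.

Lemma ord3_setT (i j k : 'I_3) : i != j -> j != k -> i != k ->
  i |: (j |: [set k]) = [set: 'I_3]%SET.
Proof.
move=> ij jk ik; apply/eqP; rewrite eqEcard finset.subsetT /= cardsT card_ord.
by rewrite !cardsU1 cards1 !inE (negPf ij) (negPf jk) (negPf ik).
Qed.

Lemma ord3_sum (V : nmodType) (F : 'I_3 -> V) (i j k : 'I_3) :
  i != j -> j != k -> i != k -> \sum_(l < 3) F l = F i + (F j + F k).
Proof.
move=> ij jk ik; transitivity (\sum_(l in [set: 'I_3]%SET) F l).
  by apply: eq_bigl => l; rewrite inE.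
rewrite -(ord3_setT ij jk ik).
by rewrite !big_setU1 ?big_set1 //= !inE ?negb_or ?ij ?ik.
Qed.

Lemma ord3_third (i j : 'I_3) : i != j -> exists k, j != k /\ i != k.
Proof.
move=> ij; have : #|~: [set i; j]%SET| == 1%N.
  by rewrite cardsCs finset.setCK cards2 ij card_ord.
move=> /cards1P[k kE]; exists k; have := set11 k.
by rewrite -kE !inE negb_or (eq_sym k) (eq_sym k) => /andP[].
Qed.

(** * Minimizing the sum of the distances *)

Section Three_balls.
Context {R : realType} {n : nat} {b : 'I_3 -> 'rV[R]_n} {s : 'I_3 -> R}.
Let Theta (i : 'I_3) := eball (b i) (s i).
Let G (x : 'rV[R]_n) := \sum_(i < 3) excess (b i) (s i) x.

(** The three convexity gaps at the midpoint are nonnegative and their sum is at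
    most zero, by minimality. *)
Lemma minimizers_midpoint x y l :
  global_minimizer G x -> global_minimizer G y ->
  2 * excess (b l) (s l) (2^-1 *: (x + y))
    = excess (b l) (s l) x + excess (b l) (s l) y.
Proof.
move=> minx miny; set m := 2^-1 *: (x + y).
pose gap i := excess (b i) (s i) x + excess (b i) (s i) y
              - 2 * excess (b i) (s i) m.
have gap_ge0 i : 0 <= gap i by rewrite subr_ge0 excess_midpoint.
have gap_sum : \sum_i gap i = G x + G y - 2 * G m.
  by rewrite sumrB big_split /= mulr_sumr.
have /eqP : \sum_i gap i = 0.
  apply/eqP; rewrite eq_le sumr_ge0 // andbT gap_sum.
  by have := minx m; have := miny m; lra.
rewrite psumr_eq0 // => /allP/(_ l (mem_index_enum _)).
by rewrite subr_eq0 => /eqP <-.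
Qed.

(** The witness is the midpoint of the two minimizers. *)
Lemma nonunique_separating x y :
  \bigcap_(i in [set: 'I_3]) Theta i = set0 -> x != y ->
  global_minimizer G x -> global_minimizer G y ->
  exists i j k : 'I_3, [/\ i <> j, j <> k & i <> k] /\
    exists u, [/\ (segment (b i) (b j) `&` Theta k) u,
                  interior (Theta k) u & #|active_set Theta u| = 1%N].
Proof.
move=> cap0 xy minx miny.
pose m := 2^-1 *: (x + y); pose c l := excess (b l) (s l) x - excess (b l) (s l) y.
have d_gt0 : 0 < enorm (x - y) by rewrite enorm_gt0 subr_eq0.
have mid l := minimizers_midpoint l minx miny.
have inactive l : ~ Theta l m -> `|c l| = enorm (x - y) /\
    c l *: (m - b l) = ((enorm (x - b l) + enorm (y - b l)) / 2) *: (x - y).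
  exact: excess_midpoint_eq.
have active l : Theta l m -> [/\ Theta l x, Theta l y & c l = 0].
  move=> ml; have := mid l; rewrite excess_in // mulr0.
  have := excess_ge0 (b l) (s l) x; have := excess_ge0 (b l) (s l) y.
  have := excess_ge (b l) (s l) x; have := excess_ge (b l) (s l) y.
  by rewrite /c /Theta /eball /= => *; split; lra.
have sumc : \sum_l c l = 0.
  rewrite sumrB; apply/eqP; rewrite subr_eq0 eq_le.
  by apply/andP; split; [exact: minx|exact: miny].
have [l ml] : exists l, ~ Theta l m.
  apply/existsNP => mT; have : (\bigcap_(i in [set: 'I_3]) Theta i) m by [].
  by rewrite cap0.
have cl : c l != 0 by rewrite -normr_gt0 (inactive l ml).1.
have [i ci] := sumr_eq0_gt0 sumc cl.
have [j cj] : exists j, 0 < - c j.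
  by apply: (@sumr_eq0_gt0 _ _ _ l); rewrite ?sumrN ?sumc ?oppr0 ?oppr_eq0.
have mi : ~ Theta i m by move=> /active[_ _ c0]; move: ci; rewrite c0 ltxx.
have mj : ~ Theta j m by move=> /active[_ _ c0]; move: cj; rewrite c0 oppr0 ltxx.
have ij : i != j by apply/eqP => ijE; move: ci cj; rewrite ijE; lra.
have [k [jk ik]] := ord3_third ij.
have [ciE rayi] := inactive i mi; have [cjE rayj] := inactive j mj.
rewrite gtr0_norm // in ciE; rewrite -normrN gtr0_norm // in cjE.
(* the changes from y to x are d, - d and 0, for d the length of x - y *)
have ck : c k = 0 by move: sumc; rewrite (ord3_sum _ ij jk ik); lra.
have mk : Theta k m.
  apply: contrapT => /inactive[] /esym; rewrite ck normr0 => d0.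
  by rewrite d0 ltxx in d_gt0.
have [xk yk _] := active k mk.
exists i, j, k; split; first by split; exact/eqP.
exists m; split; first split => //.
- have pos l' : 0 < (enorm (x - b l') + enorm (y - b l')) / 2.
    rewrite divr_gt0 //; apply: lt_le_trans d_gt0 _.
    have -> : x - y = (x - b l') + (b l' - y) by rewrite addrA subrK.
    by rewrite (enormB y) enormD.
  apply: (segment_opposite_rays d_gt0 (pos i) (pos j) (w := x - y)).
    by rewrite -rayi ciE.
  by rewrite -rayj -cjE opprK.
- by apply: interior_eball; apply: eball_midpoint_lt.
- apply/eqP/cards1P; exists k; apply/setP => l'; rewrite !inE.
  have : l' \in i |: (j |: [set k]) by rewrite ord3_setT ?inE.
  rewrite !inE => /or3P[] /eqP ->.
  + by rewrite (negPf ik); apply/negbTE/negP => /set_mem.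
  + by rewrite (negPf jk); apply/negbTE/negP => /set_mem.
  + by rewrite eqxx; apply/mem_set.
Qed.

(** The sum is everywhere at least the distance between the centers [b i] and
    [b j] minus the two radii, and this value is attained at [v]. *)
Lemma separating_minimizer (i j k : 'I_3) t
    (v := (1 - t) *: b i + t *: b j) :
  i != j -> j != k -> i != k -> t \in `[0, 1] -> Theta k v ->
  ~ Theta i v -> ~ Theta j v -> global_minimizer G v.
Proof.
move=> ij jk ik; rewrite in_itv /= => /andP[t0 t1] vk vi vj y.
rewrite /G !(ord3_sum _ ij jk ik) (excess_in vk) (excess_out vi) (excess_out vj).
have -> : v - b i = t *: (b j - b i) by apply/rowP => l; rewrite !mxE; ring.
have -> : v - b j = (1 - t) *: (b i - b j) by apply/rowP => l; rewrite !mxE; ring.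
rewrite !enormZ !ger0_norm ?subr_ge0 // (enormB (b j)).
have : enorm (b i - b j) <= enorm (y - b i) + enorm (y - b j).
  rewrite (enormB y (b i)); apply: le_trans (enormD _ _).
  by rewrite addrA subrK.
have := excess_ge (b i) (s i) y; have := excess_ge (b j) (s j) y.
by have := excess_ge0 (b k) (s k) y; lra.
Qed.

(** The point is moved towards [b j]: this takes it away from [b i], so that only
    the ball [k] and the ball [j] bound the displacement. *)
Lemma separating_nonunique (i j k : 'I_3) u :
  (forall l, 0 <= s l) -> b i != b j ->
  i != j -> j != k -> i != k -> segment (b i) (b j) u ->
  interior (Theta k) u -> #|active_set Theta u| = 1%N ->
  exists x y, [/\ x <> y, global_minimizer G x & global_minimizer G y].
Proof.
move=> s0 bij ij jk ik [t /= tI <-]; set p := fun t => (1 - t) *: b i + t *: b j.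
rewrite -/(p t) => uk act1.
have pk : Theta k (p t) := interior_subset uk.
have inactive l : l != k -> ~ Theta l (p t).
  move=> lk pl; move/eqP/cards1P: act1 => [l' l'E].
  have : l \in active_set Theta (p t) by rewrite inE; apply/mem_set.
  have : k \in active_set Theta (p t) by rewrite inE; apply/mem_set.
  by rewrite l'E !inE => /eqP kl' /eqP ll'; move: lk; rewrite ll' kl' eqxx.
have d_gt0 : 0 < enorm (b i - b j) by rewrite enorm_gt0 subr_eq0.
have pi r : 0 <= r -> enorm (p r - b i) = r * enorm (b i - b j).
  move=> r0; rewrite -[r in RHS]ger0_norm // enormB -enormZ; congr enorm.
  by apply/rowP => l; rewrite !mxE; ring.
have pj r : r <= 1 -> enorm (p r - b j) = (1 - r) * enorm (b i - b j).
  move=> r1; rewrite -[1 - r]ger0_norm ?subr_ge0 // -enormZ; congr enorm.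
  by apply/rowP => l; rewrite !mxE; ring.
move: (tI); rewrite in_itv /= => /andP[t0 t1].
have ti : s i < t * enorm (b i - b j) by rewrite -pi // ltNge; apply/negP/inactive.
have tj : s j < (1 - t) * enorm (b i - b j).
  by rewrite -pj // ltNge; apply/negP/inactive.
have p_cont : {for t, continuous p}.
  apply: (@continuousD _ _ _ (fun r : R => (1 - r) *: b i) (fun r : R => r *: b j)).
    by apply: cvgZr_tmp; apply: cvgB => [|A]; [exact: cvg_cst|exact: cvg_id].
  by apply: cvgZr_tmp => A; exact: cvg_id.
have near_k : \forall r \near t^'+, Theta k (p r).
  exact: (cvg_at_right_filter p_cont uk).
have near_j : \forall r \near t^'+, r < 1 - s j / enorm (b i - b j).
  by apply: nbhs_right_lt; rewrite ltrBrDl -ltrBrDr ltr_pdivrMr.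
have [r [[rk rj] rt]] := filter_ex (filterI (filterI near_k near_j) (nbhs_right_gt t)).
have {}rj : s j < (1 - r) * enorm (b i - b j).
  by rewrite -ltr_pdivrMr // ltrBrDr addrC -ltrBrDr.
have r0 : 0 <= r by exact: le_trans t0 (ltW rt).
have r1 : r <= 1.
  by rewrite -subr_ge0 -(pmulr_lge0 _ d_gt0) (le_trans (s0 j)) // ltW.
exists (p t), (p r); split.
- move=> ptr; have : (t - r) * enorm (b i - b j) = 0.
    by rewrite mulrBl -!pi // ptr subrr.
  by apply/eqP; rewrite mulf_eq0 negb_or (gt_eqF d_gt0) subr_eq0 lt_eqF.
- by apply: (separating_minimizer ij jk ik) => //; exact: inactive.
- apply: (separating_minimizer ij jk ik) => //.
  + by rewrite in_itv /= r0.
  + apply/negP; rewrite -ltNge pi // (lt_trans ti) // ltr_pM2r //.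
  + by apply/negP; rewrite -ltNge pj.
Qed.

End Three_balls.

Theorem theorem4p1 (R : realType) (b : 'I_3 -> 'rV[R]_2) (s : 'I_3 -> R)
    (b_inj : injective b) (s_ge0 : forall i : 'I_3, 0 <= s i) :
  let Theta := fun i : 'I_3 => eball (b i) (s i) in
  let H := fun x : 'rV[R]_2 => \sum_(i < 3) set_dist x (Theta i) in
  \bigcap_(i in [set: 'I_3]) Theta i = set0 ->
  (exists x y : 'rV[R]_2,
     [/\ x <> y, global_minimizer H x & global_minimizer H y])
  <->
  (exists i j k : 'I_3, [/\ i <> j, j <> k & i <> k] /\
     exists u : 'rV[R]_2,
       [/\ (segment (b i) (b j) `&` Theta k) u,
           interior (Theta k) u &
           #|active_set Theta u| = 1%N]).
Proof.
move=> Theta H cap0.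
have -> : H = fun x => \sum_(i < 3) excess (b i) (s i) x.
  by apply/funext => x; apply: eq_bigr => i _; rewrite set_dist_eball.
split=> [[x [y [/eqP xy minx miny]]]|].
  exact: nonunique_separating minx miny.
move=> [i [j [k [[/eqP ij /eqP jk /eqP ik] [u [[useg _] uint act1]]]]]].
have bij : b i != b j by rewrite (inj_eq b_inj).
exact: separating_nonunique s_ge0 bij ij jk ik useg uint act1.
Qed.
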